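(* Let $a,b,c,d,e,f,g,h$ be distinct elements of $[8]=\{1,\dots,8\}$, and let $A=abcd$ be the corresponding vertex of $3\text{-}QI(8,2)$. Define the vertices $$\begin{array}{llll} A_1=afgh, & B_{11}=acde, & B_{21}=abde, & B_{31}=abce,\\ A_2=aegh, & B_{12}=acdf, & B_{22}=abdf, & B_{32}=abcf,\\ A_3=aefh, & B_{13}=acdg, & B_{23}=abdg, & B_{33}=abcg,\\ A_4=aefg, & B_{14}=acdh, & B_{24}=abdh, & B_{34}=abch. \end{array}$$ The only possible maximum strongly independent sets of $3\text{-}QI(8,2)$ containing $A$ are of the following three types: Type I: $\{A,A_1,A_2,A_3,A_4\}$; Type II: $\{A,A_i,B_{1i},B_{2i},B_{3i}\}$ for some $i\in\{1,2,3,4\}$; Type III: $\{A,B_{j1},B_{j2},B_{j3},B_{j4}\}$ for some $j\in\{1,2,3\}$.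
   Context: Definition of $3\text{-}QI(8,2)$: its vertices are all binary strings of length $8$ with entries in $\{0,1\}$ whose first entry is $0$ and in which each symbol occurs at least $4$ (hence exactly $4$) times; equivalently, the unordered partitions $\{X,\overline{X}\}$ of $[8]$ with $|X|=|\overline{X}|=4$. Three vertices form a hyperedge if and only if they are $3$-qualitatively independent: for every $(g_1,g_2,g_3)\in\{0,1\}^3$ there is an index $j$ with $v_i[j]=g_i$ for $i=1,2,3$ (equivalently, all eight triple intersections of parts, one part from each partition, are non-empty). There are no other hyperedges. Notation: a four-letter word such as $abcd$ denotes the vertex $\{X,\overline{X}\}$ with $X=\{a,b,c,d\}$. A set of vertices of a hypergraph is strongly independent if no two of its (distinct) elements belong to a common hyperedge. A maximum strongly independent set is a strongly independent set of largest possible cardinality in the hypergraph. *)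

(* Defs.v *)
From HB Require Import structures.
From mathcomp Require Import all_boot.

Set Implicit Arguments.
Unset Strict Implicit.
Unset Printing Implicit Defensive.

(* The index set [8] is 'I_8 (so the first entry of a string has index 0),    *)
(* and the alphabet {0,1} is bool, with 0 = false and 1 = true.               *)

Definition is_vertex (v : 8.-tuple bool) : bool :=
  (tnth v ord0 == false) &&
  [forall s : bool, 4 <= #|[set j : 'I_8 | tnth v j == s]|].

Record vertex := Vertex { string_of :> 8.-tuple bool; _ : is_vertex string_of }.

HB.instance Definition _ := [isSub for string_of].
HB.instance Definition _ := [Equality of vertex by <:].
HB.instance Definition _ := [Choice of vertex by <:].
HB.instance Definition _ := [Countable of vertex by <:].
HB.instance Definition _ := [Finite of vertex by <:].

Definition qual_indep3 (v1 v2 v3 : vertex) : bool :=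
  [forall g1 : bool, [forall g2 : bool, [forall g3 : bool,
    [exists j : 'I_8,
      [&& tnth v1 j == g1, tnth v2 j == g2 & tnth v3 j == g3]]]]].

Definition QI3_8_2 : {set {set vertex}} :=
  [set E : {set vertex} | (#|E| == 3) &&
    [exists v1, [exists v2, [exists v3,
      (E == [set v1; v2; v3]) && qual_indep3 v1 v2 v3]]]].

Section Hypergraph.

(* H is the set of hyperedges of a hypergraph with vertex set T. *)
Variables (T : finType) (H : {set {set T}}).

Definition strongly_independent (S : {set T}) : Prop :=
  forall x y, x \in S -> y \in S -> x != y ->
    ~ (exists2 E, E \in H & (x \in E) && (y \in E)).

(* Largest cardinality, not merely maximal for inclusion. *)
Definition maximum_strongly_independent (S : {set T}) : Prop :=
  strongly_independent S /\
  (forall S' : {set T}, strongly_independent S' -> #|S'| <= #|S|).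

End Hypergraph.

Definition parts (v : vertex) : {set {set 'I_8}} :=
  [set [set j : 'I_8 | tnth v j == s] | s : bool].

(* The characteristic string of X or of its complement, whichever starts      *)
(* with 0.                                                                    *)
Definition string_of_set (X : {set 'I_8}) : 8.-tuple bool :=
  [tuple (j \in X) (+) (ord0 \in X) | j < 8].

Lemma string_of_setE (X : {set 'I_8}) (j : 'I_8) :
  tnth (string_of_set X) j = (j \in X) (+) (ord0 \in X).
Proof. by rewrite tnth_mktuple. Qed.

Lemma string_of_set_class (X : {set 'I_8}) (s : bool) :
  [set j : 'I_8 | tnth (string_of_set X) j == s] =
  if s (+) (ord0 \in X) then X else ~: X.
Proof.
apply/setP=> j; rewrite inE string_of_setE.
case: (boolP (ord0 \in X)) => _; case: s => /=; rewrite ?inE;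
  by case: (j \in X).
Qed.

Lemma string_of_set_is_vertex (X : {set 'I_8}) :
  #|X| = 4 -> is_vertex (string_of_set X).
Proof.
move=> cX; have cXC : #|~: X| = 4.
  by apply/eqP; rewrite -(eqn_add2l #|X|) cardsC cX card_ord.
rewrite /is_vertex string_of_setE addbb eqxx /=; apply/forallP=> s.
by rewrite string_of_set_class; case: ifP; rewrite ?cX ?cXC.
Qed.

Lemma card_ord8_lt4 : #|[set j : 'I_8 | j < 4]| = 4.
Proof. by rewrite -sum1dep_card big_mkcond !big_ord_recl big_ord0. Qed.

Definition vertex0 : vertex := Vertex (string_of_set_is_vertex card_ord8_lt4).

(* The vertex {X, ~: X}, see parts_vertex_of_set; the default value vertex0   *)
(* of insubd is only used when #|X| != 4.                                     *)
Definition vertex_of_set (X : {set 'I_8}) : vertex :=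
  insubd vertex0 (string_of_set X).

Lemma parts_vertex_of_set (X : {set 'I_8}) :
  #|X| = 4 -> parts (vertex_of_set X) = [set X; ~: X].
Proof.
move=> cX; have vX : string_of (vertex_of_set X) = string_of_set X.
  by rewrite -[LHS]/(val _) val_insubd string_of_set_is_vertex.
apply/setP=> Y; rewrite !inE; apply/imsetP/orP => [[s _ ->]|].
  by rewrite vX string_of_set_class; case: ifP; rewrite eqxx; [left|right].
case=> /eqP->; [exists (~~ (ord0 \in X)) | exists (ord0 \in X)] => //;
  by rewrite vX string_of_set_class; case: (ord0 \in X).
Qed.

Definition word (a b c d : 'I_8) : vertex := vertex_of_set [set a; b; c; d].

(* Main.v *)
Require Import Defs.
From mathcomp Require Import all_boot zify ring.

Set Implicit Arguments.
Unset Strict Implicit.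
Unset Printing Implicit Defensive.

(** Write the vertices as {X, ~: X} with X a half (a four-element subset) of
    the index set.  Two distinct vertices {X, ~: X} and {Y, ~: Y} lie in a
    common hyperedge exactly when [#|X :&: Y| = 2]
    ([share_hyperedge_card]): a third vertex can be added to the pair iff each
    of the four intersections of parts can be split, i.e. has at least two
    elements.

    So the vertices that may accompany A in a strongly independent set are
    those meeting the half A in one or three elements.  Up to complementation
    they are the sixteen exchanges A - p + q, with p in A and q outside A
    ([not_share_exchanged]).  Two such exchanges meet in three elements when
    they have p or q in common, and in two elements otherwise
    ([card_exchangeI]).  Hence, on the 4 x 4 grid of pairs (p, q),
    strong independence means that any two cells are in the same row or in the
    same column, and this forces all the cells into one row or one column
    ([strongly_independent_sub_line]).

    Every strongly independent set thus has at most five elements, and the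
    maximum ones containing A consist of A and of one full row or column of its
    grid ([maximum_strongly_independent_line]).  Since A - a + q is the
    complement of a word starting with a, the row of a gives type I, the rows
    of b, c and d give type III, and the columns give type II. *)

(** * Vertices as halves of the index set *)

Lemma string_of_vertex_of_set (X : {set 'I_8}) :
  #|X| = 4 -> string_of (vertex_of_set X) = string_of_set X.
Proof.
by move=> cX; rewrite -[LHS]/(val _) val_insubd string_of_set_is_vertex.
Qed.

Lemma vertex_of_setC (X : {set 'I_8}) : vertex_of_set (~: X) = vertex_of_set X.
Proof.
congr (insubd _ _); apply: eq_from_tnth => j.
by rewrite !string_of_setE !inE addbN addNb negbK.
Qed.

Lemma cardsC4 (X : {set 'I_8}) : #|X| = 4 -> #|~: X| = 4.
Proof. by move=> cX; have := cardsC X; rewrite card_ord cX; lia. Qed.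

Lemma vertex_of_setP (v : vertex) :
  exists2 X : {set 'I_8}, #|X| = 4 & v = vertex_of_set X.
Proof.
case/andP: (valP v) => /eqP v0 /forallP v_ge4.
pose X := [set j : 'I_8 | tnth v j == true].
have cX : #|X| = 4.
  have cXC : ~: X = [set j : 'I_8 | tnth v j == false].
    by apply/setP=> j; rewrite !inE; case: (tnth v j).
  have := v_ge4 true; have := v_ge4 false; have := cardsC X.
  by rewrite card_ord cXC /= -/X; lia.
exists X => //; apply: val_inj; rewrite /= string_of_vertex_of_set //.
by apply: eq_from_tnth => j; rewrite string_of_setE !inE v0 addbF eqb_id.
Qed.

Lemma eq_vertex_of_set (X Y : {set 'I_8}) :
  #|X| = 4 -> #|Y| = 4 -> vertex_of_set X = vertex_of_set Y ->
  X = Y \/ X = ~: Y.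
Proof.
move=> cX cY eXY; have : X \in parts (vertex_of_set Y).
  by rewrite -eXY parts_vertex_of_set // !inE eqxx.
by rewrite parts_vertex_of_set // !inE => /orP[] /eqP; [left | right].
Qed.

(** * Pairs of vertices in a common hyperedge *)

(** The relation excluded between distinct elements by [strongly_independent],
    for the hypergraph [QI3_8_2]. *)
Definition share_hyperedge (v w : vertex) : Prop :=
  exists2 E, E \in QI3_8_2 & (v \in E) && (w \in E).

Definition cell (v w : vertex) (g : bool * bool) : {set 'I_8} :=
  [set j | (tnth v j == g.1) && (tnth w j == g.2)].

(** The third vertex is singled out: its role is to split the cells of the
    first two. *)
Lemma qual_indep3P (v1 v2 v3 : vertex) :
  reflect (forall g3 g, exists2 j, j \in cell v1 v2 g & tnth v3 j = g3)
          (qual_indep3 v1 v2 v3).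
Proof.
apply: (iffP idP) => [qi g3 [g1 g2] | qi].
  move/forallP/(_ g1)/forallP/(_ g2)/forallP/(_ g3)/existsP: qi => [j].
  by case/and3P=> e1 e2 /eqP; exists j; rewrite ?inE ?e1.
apply/forallP=> g1; apply/forallP=> g2; apply/forallP=> g3; apply/existsP.
have [j] := qi g3 (g1, g2); rewrite inE => /andP[e1 e2] e3.
by exists j; rewrite e1 e2 e3 eqxx.
Qed.

Lemma qual_indep3_rot (v1 v2 v3 : vertex) :
  qual_indep3 v1 v2 v3 -> qual_indep3 v2 v3 v1.
Proof.
move=> /qual_indep3P qi; apply/qual_indep3P=> g1 [g2 g3].
have [j] := qi g3 (g1, g2); rewrite !inE => /andP[/eqP e1 e2] e3.
by exists j; rewrite // inE e2 e3 eqxx.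
Qed.

Lemma qual_indep3_swap (v1 v2 v3 : vertex) :
  qual_indep3 v1 v2 v3 -> qual_indep3 v2 v1 v3.
Proof.
move=> /qual_indep3P qi; apply/qual_indep3P=> g3 [g2 g1].
have [j] := qi g3 (g1, g2); rewrite !inE => /andP[e1 e2] e3.
by exists j; rewrite // inE e2 e1.
Qed.

Lemma qual_indep3_neq (v1 v2 v3 : vertex) : qual_indep3 v1 v2 v3 -> v1 != v2.
Proof.
move=> /qual_indep3P/(_ true (true, false))[j].
rewrite inE => /andP[/eqP e1 /eqP e2] _.
by apply/eqP=> e12; rewrite -e12 e1 in e2.
Qed.

(** A hyperedge has exactly three vertices, so once [v != w] it is determined by
    its third one; the six cases are the positions that [v] and [w] may have in
    the enumeration of the hyperedge. *)
Lemma share_hyperedgeP (v w : vertex) :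
  v != w -> share_hyperedge v w <-> exists u, qual_indep3 v w u.
Proof.
move=> nvw; split=> [[E] | [u qi]].
  rewrite inE => /andP[_ /existsP[v1 /existsP[v2 /existsP[v3]]]].
  case/andP=> /eqP-> qi; rewrite !inE => /andP[vE wE].
  have qi2 := qual_indep3_rot qi; have qi3 := qual_indep3_rot qi2.
  have qi' := qual_indep3_swap qi; have qi2' := qual_indep3_swap qi2.
  have qi3' := qual_indep3_swap qi3.
  by case/orP: vE nvw => [/orP[]|] /eqP->;
     case/orP: wE => [/orP[]|] /eqP->; rewrite ?eqxx // => _;
     [exists v3 | exists v2 | exists v3 | exists v1 | exists v2 | exists v1].
exists [set v; w; u]; last by rewrite !inE !eqxx orbT.
rewrite inE; apply/andP; split.
  have nwu := qual_indep3_neq (qual_indep3_rot qi).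
  have nuv := qual_indep3_neq (qual_indep3_rot (qual_indep3_rot qi)).
  by rewrite eq_sym in nuv; rewrite -setUA cardsU1 cards2 !inE negb_or nvw nuv nwu.
apply/existsP; exists v; apply/existsP; exists w; apply/existsP; exists u.
by rewrite eqxx.
Qed.

(** A third vertex must take both values on every cell of [v] and [w].
    Conversely, when each cell has at least two elements, choosing one element of each of the
    four cells gives a half of the index set that splits all cells. *)
Lemma share_hyperedge_cells (v w : vertex) :
  v != w -> share_hyperedge v w <-> forall g, 1 < #|cell v w g|.
Proof.
move=> nvw; rewrite share_hyperedgeP //; split=> [[u /qual_indep3P qi] g | Hg].
  have [[i gi ui] [j gj uj]] := (qi true g, qi false g).
  apply/card_gt1P; exists i, j; split=> //.
  by apply/eqP=> eij; rewrite eij uj in ui.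
have /fin_all_exists2[pq pqP pq_neq] : forall g, exists2 pq : 'I_8 * 'I_8,
    (pq.1 \in cell v w g) && (pq.2 \in cell v w g) & pq.1 != pq.2.
  move=> g; have /card_gt1P[p [q [gp gq npq]]] := Hg g.
  by exists (p, q); rewrite /= ?gp ?gq.
have cell_inj g g' j : j \in cell v w g -> j \in cell v w g' -> g = g'.
  case: g g' => g1 g2 [g1' g2']; rewrite !inE /= => /andP[/eqP<- /eqP<-].
  by case/andP=> /eqP<- /eqP<-.
(* One element of each cell, so that [Z] is a half splitting every cell. *)
pose Z := [set (pq g).1 | g : bool * bool].
have cZ : #|Z| = 4.
  rewrite card_imset ?card_prod ?card_bool // => g g' e.
  have /andP[gp _] := pqP g; have /andP[gp' _] := pqP g'.
  by rewrite -e in gp'; exact: cell_inj gp gp'.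
have qNZ g : (pq g).2 \notin Z.
  apply/imsetP=> -[g' _ e]; have /andP[_ gq] := pqP g.
  have /andP[gp' _] := pqP g'; rewrite e in gq.
  by have := pq_neq g; rewrite e (cell_inj _ _ _ gq gp') eqxx.
exists (vertex_of_set Z); apply/qual_indep3P=> g3 g.
have /andP[gp gq] := pqP g.
(* [vertex_of_set Z] is the characteristic string of [Z] or of [~: Z],
   according to the side containing [ord0]. *)
exists (if g3 (+) (ord0 \in Z) then (pq g).1 else (pq g).2); first by case: ifP.
rewrite string_of_vertex_of_set // string_of_setE.
have pZ : (pq g).1 \in Z by apply: imset_f.
by case: ifP; rewrite ?pZ ?(negbTE (qNZ g)); case: g3; case: (ord0 \in Z).
Qed.

(** Both parts of both vertices have four elements, so the four cells have
    sizes n, 4 - n, 4 - n and n, with n the size of [X :&: Y]; all of them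
    exceed 1 only for n = 2. *)
Lemma share_hyperedge_card (X Y : {set 'I_8}) :
    #|X| = 4 -> #|Y| = 4 -> vertex_of_set X != vertex_of_set Y ->
  share_hyperedge (vertex_of_set X) (vertex_of_set Y) <-> #|X :&: Y| = 2.
Proof.
move=> cX cY nXY; rewrite share_hyperedge_cells //.
have cellE g : cell (vertex_of_set X) (vertex_of_set Y) g =
    (if g.1 (+) (ord0 \in X) then X else ~: X) :&:
    (if g.2 (+) (ord0 \in Y) then Y else ~: Y).
  rewrite -!string_of_set_class; apply/setP=> j.
  by rewrite !inE !string_of_vertex_of_set.
have cXY : #|X :&: ~: Y| = 4 - #|X :&: Y|.
  by rewrite -setDE cardsD cX.
have cYX : #|~: X :&: Y| = 4 - #|X :&: Y|.
  by rewrite setIC (setIC X) -setDE cardsD cY.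
have cXYC : #|~: X :&: ~: Y| = 4 - (4 - #|X :&: Y|).
  by rewrite -cYX -setDE cardsD (cardsC4 cX).
split=> [Hg | XY2 g].
  have := Hg (~~ (ord0 \in X), ord0 \in Y).
  have := Hg (~~ (ord0 \in X), ~~ (ord0 \in Y)).
  rewrite !cellE /= !addNb !addbb cXY.
  by move: #|_| => n; lia.
by rewrite cellE; case: ifP => _; case: ifP => _; rewrite ?cXYC ?cXY ?cYX XY2.
Qed.

(** * Exchanging one element of a half *)

Definition exchange (A : {set 'I_8}) (pq : 'I_8 * 'I_8) : {set 'I_8} :=
  pq.2 |: A :\ pq.1.

Definition exchanged (A : {set 'I_8}) (pq : 'I_8 * 'I_8) : vertex :=
  vertex_of_set (exchange A pq).

Lemma cardsD1_4 (A : {set 'I_8}) p : #|A| = 4 -> p \in A -> #|A :\ p| = 3.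
Proof. by move=> cA pA; move: cA; rewrite (cardsD1 p A) pA => -[]. Qed.

Lemma card_exchange (A : {set 'I_8}) pq :
  #|A| = 4 -> pq \in setX A (~: A) -> #|exchange A pq| = 4.
Proof.
case: pq => p q cA; rewrite !inE /= => /andP[pA qA].
by rewrite cardsU1 !inE (negbTE qA) andbF cardsD1_4.
Qed.

Lemma card_setI_exchange (A : {set 'I_8}) pq :
  #|A| = 4 -> pq \in setX A (~: A) -> #|A :&: exchange A pq| = 3.
Proof.
case: pq => p q cA; rewrite !inE /= => /andP[pA qA].
rewrite (_ : _ :&: _ = A :\ p); first exact: cardsD1_4.
apply/setP=> j; rewrite !inE /=; case: (j =P q) => [->|_] /=.
  by rewrite (negbTE qA) andbF.
by case: (j \in A); rewrite ?andbF.
Qed.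

(** The rook graph structure of the exchanges: with [share_hyperedge_card],
    two of them are in a common hyperedge iff they differ in both
    coordinates. *)
Lemma card_exchangeI (A : {set 'I_8}) pq rs : #|A| = 4 ->
    pq \in setX A (~: A) -> rs \in setX A (~: A) -> pq != rs ->
  #|exchange A pq :&: exchange A rs| =
  if (pq.1 == rs.1) || (pq.2 == rs.2) then 3 else 2.
Proof.
case: pq rs => p q [r s] cA; rewrite !inE xpair_eqE /exchange /=.
move=> /andP[pA qA] /andP[rA sA] neq.
have cAp := cardsD1_4 cA pA.
have cApr : p != r -> #|A :\ p :\ r| = 2.
  by move=> npr; move: cAp; rewrite (cardsD1 r) !inE eq_sym npr rA => -[].
have [epr | npr] := eqVneq p r; last have [eqs | nqs] := eqVneq q s.
- move: neq; rewrite -epr eqxx /= => nqs.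
  apply: etrans cAp; congr #|pred_of_set _|.
  apply/setP=> j; rewrite !inE.
  by have [->|_] := eqVneq j q; rewrite ?(negbTE nqs) ?(negbTE qA) ?andbF //=;
    have [->|_] := eqVneq j s; rewrite ?(negbTE sA) ?andbF ?andbb.
- rewrite -eqs -setUIr cardsU1 !inE (negbTE qA) !andbF /=.
  apply: (congr1 S (etrans _ (cApr npr))); congr #|pred_of_set _|.
  apply/setP=> j; rewrite !inE.
  by case: (j \in A); rewrite ?andbF // !andbT andbC.
rewrite /=; apply: etrans (cApr npr); congr #|pred_of_set _|.
apply/setP=> j; rewrite !inE.
have [->|_] := eqVneq j q.
  by rewrite (negbTE nqs) (negbTE qA) !andbF.
have [->|_] := eqVneq j s; first by rewrite (negbTE sA) !andbF.
by rewrite /=; case: (j \in A); rewrite ?andbF // !andbT andbC.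
Qed.

(** Halves of the same vertex are equal or disjoint. *)
Lemma vertex_of_set_neq (X Y : {set 'I_8}) : #|X| = 4 -> #|Y| = 4 ->
  0 < #|X :&: Y| < 4 -> vertex_of_set X != vertex_of_set Y.
Proof.
move=> cX cY; apply: contraTneq => /(eq_vertex_of_set cX cY)[->|->].
  by rewrite setIid cY.
by rewrite setIC setICr cards0.
Qed.

Lemma exchanged_neq (A : {set 'I_8}) pq : #|A| = 4 ->
  pq \in setX A (~: A) -> exchanged A pq != vertex_of_set A.
Proof.
move=> cA Apq; rewrite eq_sym vertex_of_set_neq ?(card_exchange cA Apq) //.
by rewrite card_setI_exchange.
Qed.

Lemma exchanged_inj (A : {set 'I_8}) : #|A| = 4 ->
  {in setX A (~: A) &, injective (exchanged A)}.
Proof.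
move=> cA pq rs Apq Ars; apply: contra_eq => neq.
rewrite vertex_of_set_neq ?(card_exchange cA) ?card_exchangeI //.
by case: ifP.
Qed.

(** A vertex sharing no hyperedge with [A] meets it in one or three elements;
    replacing its half by the complement if necessary, this number is three. *)
Lemma not_share_exchanged (A : {set 'I_8}) w :
    #|A| = 4 -> w != vertex_of_set A ->
    ~ share_hyperedge (vertex_of_set A) w ->
  exists2 pq, pq \in setX A (~: A) & w = exchanged A pq.
Proof.
move=> cA nwA; have [Y cY def_w] := vertex_of_setP w.
rewrite eq_sym def_w in nwA *; rewrite share_hyperedge_card // => AY_neq2.
wlog AY3 : Y cY nwA AY_neq2 {def_w} / #|A :&: Y| = 3.
  move=> IH; have cYC := cardsC4 cY.
  have cAYC : #|A :&: ~: Y| = 4 - #|A :&: Y| by rewrite -setDE cardsD cA.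
  have [AY4 AY0] : #|A :&: Y| <> 4 /\ #|A :&: Y| <> 0.
    split=> [AY4 | /eqP]; last first.
      rewrite cards_eq0 setI_eq0 disjoints_subset => sAYC.
      have /eqP eAYC : A == ~: Y by rewrite eqEcard sAYC cA cYC.
      by rewrite eAYC vertex_of_setC eqxx in nwA.
    have /eqP eA : A :&: Y == A by rewrite eqEcard subsetIl AY4 cA.
    have /eqP eY : A :&: Y == Y by rewrite eqEcard subsetIr AY4 cY.
    by rewrite -{1}eA eY eqxx in nwA.
  have AYle4 : #|A :&: Y| <= 4 by have := subset_leq_card (subsetIl A Y); rewrite cA.
  have [AY3 | AYn3] := eqVneq #|A :&: Y| 3; first exact: IH.
  rewrite -(vertex_of_setC Y) in nwA *; apply: IH => //; rewrite cAYC;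
    by move: #|_| AY4 AY0 AYle4 AYn3 AY_neq2 => n; lia.
have /eqP/cards1P[p Ep] : #|A :\: Y| = 1 by rewrite cardsD cA AY3.
have /eqP/cards1P[q Eq] : #|Y :\: A| = 1 by rewrite cardsD cY setIC AY3.
have /setDP[pA pY] : p \in A :\: Y by rewrite Ep set11.
have /setDP[qY qA] : q \in Y :\: A by rewrite Eq set11.
exists (p, q); first by rewrite !inE pA qA.
congr vertex_of_set; rewrite /exchange /= -Ep -Eq setDDr setDv set0U setIC.
by rewrite setUC setID.
Qed.

(** * Rows and columns of the grid of exchanges *)


Definition block (A P Q : {set 'I_8}) : {set vertex} :=
  vertex_of_set A |: [set exchanged A pq | pq in setX P Q].

(** A row or a column of the 4 x 4 grid of exchanges of [A], completed with
    [A] itself. *)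
Definition line (A : {set 'I_8}) (L : {set vertex}) : Prop :=
  (exists2 p, p \in A & L = block A [set p] (~: A)) \/
  (exists2 q, q \in ~: A & L = block A A [set q]).

(** The two kinds of lines have in common what makes them strongly independent
    and what determines their size. *)
Lemma line_block (A : {set 'I_8}) L : #|A| = 4 -> line A L ->
  exists P Q, [/\ L = block A P Q, setX P Q \subset setX A (~: A),
    {in setX P Q &, forall x y, (x.1 == y.1) || (x.2 == y.2)} & #|P| * #|Q| = 4].
Proof.
move=> cA [[p pA] | [q qA]] ->.
  exists [set p], (~: A); split; rewrite ?cards1 ?cardsC4 //.
    by apply: setXS; rewrite ?sub1set.
  by move=> [? ?] [? ?] /setXP[/set1P-> _] /setXP[/set1P-> _]; rewrite /= eqxx.
exists A, [set q]; split; rewrite ?cards1 ?cA //.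
  by apply: setXS; rewrite ?sub1set.
by move=> [? ?] [? ?] /setXP[_ /set1P->] /setXP[_ /set1P->]; rewrite /= eqxx orbT.
Qed.

Lemma card_line (A : {set 'I_8}) L : #|A| = 4 -> line A L -> #|L| = 5.
Proof.
move=> cA /(line_block cA)[P [Q [-> /subsetP sPQ _ cPQ]]].
rewrite cardsU1 card_in_imset ?cardsX ?cPQ; last first.
  by move=> x y /sPQ Ax /sPQ Ay; apply: exchanged_inj.
case: imsetP => // -[x /sPQ Ax e].
by have := exchanged_neq cA Ax; rewrite -e eqxx.
Qed.

Lemma share_hyperedge_sym (v w : vertex) :
  share_hyperedge v w -> share_hyperedge w v.
Proof. by case=> E HE; rewrite andbC; exists E. Qed.

Lemma strongly_independent_line (A : {set 'I_8}) L :
  #|A| = 4 -> line A L -> strongly_independent QI3_8_2 L.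
Proof.
move=> cA /(line_block cA)[P [Q [-> /subsetP sPQ PQline _]]] v w.
have not_share x : x \in setX P Q ->
    ~ share_hyperedge (vertex_of_set A) (exchanged A x).
  move=> /sPQ Ax; rewrite share_hyperedge_card ?(card_exchange cA Ax) //.
    by rewrite card_setI_exchange.
  by rewrite eq_sym exchanged_neq.
case/setU1P=> [->|/imsetP[x PQx ->]] /setU1P[->|/imsetP[y PQy ->]].
- by rewrite eqxx.
- by move=> _; apply: not_share.
- by move=> _ /share_hyperedge_sym; apply: not_share.
have [Ax Ay] := (sPQ _ PQx, sPQ _ PQy) => nxy.
have neq : x != y by apply: contraNneq nxy => ->.
have cE := card_exchange cA; rewrite -/(share_hyperedge _ _) share_hyperedge_card ?cE //.
by rewrite card_exchangeI // PQline.
Qed.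

(** If two cells of the grid differ in their first coordinate, they agree in
    the second one; a third cell collinear with both of them must then have
    this same second coordinate, for it cannot agree with both in the first. *)
Lemma strongly_independent_sub_line (A : {set 'I_8}) S :
    #|A| = 4 -> strongly_independent QI3_8_2 S -> vertex_of_set A \in S ->
  exists2 L, line A L & S \subset L.
Proof.
move=> cA siS AS.
have S_exchanged w : w \in S -> w != vertex_of_set A ->
    exists2 pq, pq \in setX A (~: A) & w = exchanged A pq.
  move=> wS nwA; apply: not_share_exchanged => //.
  by apply: siS => //; rewrite eq_sym.
pose G := [set pq in setX A (~: A) | exchanged A pq \in S].
have G_coord x : x \in G -> x.1 \in A /\ x.2 \in ~: A.
  by case: x => ? ? /setIdP[/setXP].
have G_collinear : {in G &, forall x y, (x.1 == y.1) || (x.2 == y.2)}.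
  move=> x y /setIdP[Ax Sx] /setIdP[Ay Sy].
  have [->|nxy] := eqVneq x y; first by rewrite eqxx.
  have nexy : exchanged A x != exchanged A y.
    by apply: contra_neq nxy; apply: exchanged_inj.
  apply/negPn/negP=> ncol; apply: (siS _ _ Sx Sy nexy).
  apply/share_hyperedge_card; rewrite ?(card_exchange cA) //.
  by rewrite card_exchangeI // (negbTE ncol).
have S_sub_block P Q : G \subset setX P Q -> S \subset block A P Q.
  move=> /subsetP sG; apply/subsetP=> w wS; rewrite in_setU1.
  have [//|nwA /=] := eqVneq w (vertex_of_set A).
  have [pq Apq def_w] := S_exchanged w wS nwA.
  by rewrite def_w imset_f // sG // inE Apq -def_w.
(* When [S] contains only [A], any line will do. *)
have [G0 | [x Gx]] := set_0Vmem G.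
  have /card_gt0P[p pA] : 0 < #|A| by rewrite cA.
  exists (block A [set p] (~: A)); first by left; exists p.
  by rewrite S_sub_block // G0 sub0set.
have [x1A x2A] := G_coord x Gx.
have [row | /forallPn[y]] := boolP [forall y, (y \in G) ==> (y.1 == x.1)].
  exists (block A [set x.1] (~: A)); first by left; exists x.1.
  apply/S_sub_block/subsetP=> y Gy; have := implyP (forallP row y) Gy.
  by have [_ y2A] := G_coord y Gy; rewrite inE y2A andbT inE.
rewrite negb_imply => /andP[Gy /negbTE ny1].
have /eqP y2 : y.2 == x.2 by have := G_collinear _ _ Gy Gx; rewrite ny1.
exists (block A A [set x.2]); first by right; exists x.2.
apply/S_sub_block/subsetP=> z Gz; have [z1A _] := G_coord z Gz.
rewrite inE z1A inE /=; have := G_collinear _ _ Gz Gx.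
case: eqP => //= z1 _; have := G_collinear _ _ Gz Gy.
by rewrite z1 eq_sym ny1 y2.
Qed.

(** Any element of [S] can play the role of the base vertex [A]. *)
Lemma strongly_independent_card (S : {set vertex}) :
  strongly_independent QI3_8_2 S -> #|S| <= 5.
Proof.
move=> siS; have [->|[w wS]] := set_0Vmem S; first by rewrite cards0.
have [A cA def_w] := vertex_of_setP w; rewrite def_w in wS.
have [L lineL /subset_leq_card] := strongly_independent_sub_line cA siS wS.
by rewrite (card_line cA lineL).
Qed.

Lemma maximum_strongly_independent_line (A : {set 'I_8}) S : #|A| = 4 ->
  (maximum_strongly_independent QI3_8_2 S /\ vertex_of_set A \in S) <-> line A S.
Proof.
move=> cA; split=> [[[siS maxS] AS] | lineS].
  have [L lineL sSL] := strongly_independent_sub_line cA siS AS.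
  have /eqP-> // : S == L.
  by rewrite eqEcard sSL maxS //; apply: strongly_independent_line cA lineL.
split; last by case: lineS => -[? _ ->]; apply: setU11.
split; first exact: strongly_independent_line cA lineS.
by move=> S' siS'; rewrite (card_line cA lineS) strongly_independent_card.
Qed.

(** * Lines written with four-letter words *)

Lemma imset_ord (T : finType) (F : nat -> T) n :
  [set F i | i : 'I_n] = [set x in mkseq F n].
Proof.
apply/setP=> x; rewrite inE; apply/imsetP/mapP=> [[i _ ->]|[i]].
  by exists (val i); rewrite // mem_iota ltn_ord.
by rewrite mem_iota => /= lt_i_n ->; exists (Ordinal lt_i_n).
Qed.

Lemma setC_complementary_seq (s t : seq 'I_8) :
  uniq (s ++ t) -> size (s ++ t) = 8 -> ~: [set x in s] = [set x in t].
Proof.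
move=> Ust sz_st; apply/setP=> x; rewrite !inE.
have c_st : #|s ++ t| = #|'I_8| by rewrite (card_uniqP Ust) sz_st card_ord.
have : x \in s ++ t by rewrite (elimT (subset_cardP c_st) (subset_predT _)).
rewrite mem_cat => xst; case/boolP: (x \in s) xst => //= xs _.
apply/esym/negbTE/negP=> xt.
by move: Ust; rewrite cat_uniq => /and3P[_ /hasPn/(_ _ xt)/negP[]].
Qed.

Lemma set4_seq (T : finType) (x y z t : T) :
  [set x; y; z; t] = [set u in [:: x; y; z; t]].
Proof. by apply/setP=> u; rewrite !inE !orbA. Qed.

Lemma word_compl (a b c d e f g h : 'I_8) :
  uniq [:: a; b; c; d; e; f; g; h] -> word a b c d = word e f g h.
Proof.
move=> U; rewrite /word -vertex_of_setC !set4_seq.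
by rewrite (@setC_complementary_seq [:: a; b; c; d] [:: e; f; g; h] U).
Qed.

Lemma exchanged_word (A : {set 'I_8}) p q x y z :
    A = p |: [set x; y; z] -> p \notin [:: x; y; z] ->
  exchanged A (p, q) = word x y z q.
Proof.
move=> -> pxyz; congr vertex_of_set; rewrite /exchange /= setU1K.
  by rewrite setUC.
by move: pxyz; rewrite !inE !orbA.
Qed.

Lemma block_row (A Q : {set 'I_8}) p (s : seq 'I_8) : Q = [set x in s] ->
  block A [set p] Q =
  vertex_of_set A |: [set v in [seq exchanged A (p, q) | q <- s]].
Proof.
move=> ->; congr (_ |: _); apply/setP=> v; rewrite inE.
apply/imsetP/mapP=> [[[r q] /setXP[/set1P-> ]]|[q qs ->]].
  by rewrite inE => qs ->; exists q.
by exists (p, q) => //; rewrite !inE eqxx.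
Qed.

Lemma block_col (A P : {set 'I_8}) q (s : seq 'I_8) : P = [set x in s] ->
  block A P [set q] =
  vertex_of_set A |: [set v in [seq exchanged A (p, q) | p <- s]].
Proof.
move=> ->; congr (_ |: _); apply/setP=> v; rewrite inE.
apply/imsetP/mapP=> [[[p r] /setXP[+ /set1P->]]|[p ps ->]].
  by rewrite inE => ps ->; exists p.
by exists (p, q) => //; rewrite !inE ps eqxx.
Qed.

Theorem theorem2 (a b c d e f g h : 'I_8)
    (Hdistinct : uniq [:: a; b; c; d; e; f; g; h])
    (S : {set vertex}) :
  let A := word a b c d in
  let A_ (i : 'I_4) := nth A
    [:: word a f g h; word a e g h; word a e f h; word a e f g] i in
  let B_ (j : 'I_3) (i : 'I_4) := nth A (nth [::]
    [:: [:: word a c d e; word a c d f; word a c d g; word a c d h];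
        [:: word a b d e; word a b d f; word a b d g; word a b d h];
        [:: word a b c e; word a b c f; word a b c g; word a b c h]] j) i in
  (maximum_strongly_independent QI3_8_2 S /\ A \in S) <->
  [\/ S = A |: [set A_ i | i : 'I_4],
      exists i : 'I_4, S = A |: (A_ i |: [set B_ j i | j : 'I_3])
    | exists j : 'I_3, S = A |: [set B_ j i | i : 'I_4]].
Proof.
move=> A A_ B_; pose X := [set a; b; c; d].
have X_seq : X = [set x in [:: a; b; c; d]] := set4_seq a b c d.
have XC_seq : ~: X = [set x in [:: e; f; g; h]].
  by rewrite X_seq; exact: (@setC_complementary_seq [:: _; _; _; _] _ Hdistinct).
have U4 : uniq [:: a; b; c; d].
  by move: Hdistinct; rewrite -[_ :: _]/([:: a; b; c; d] ++ _) cat_uniq => /and3P[].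
have cX : #|X| = 4 by rewrite X_seq cardsE; apply/card_uniqP.
have exchE x y z t q : perm_eq [:: x; y; z; t] [:: a; b; c; d] ->
    exchanged X (x, q) = word y z t q.
  move=> xyzt; apply: exchanged_word.
    by apply/setP=> j; rewrite X_seq inE -(perm_mem xyzt) !inE !orbA.
  by move: U4; rewrite -(perm_uniq xyzt) => /andP[].
have complE x y z t x' y' z' t' :
    perm_eq [:: x; y; z; t; x'; y'; z'; t'] [:: a; b; c; d; e; f; g; h] ->
    word x y z t = word x' y' z' t'.
  by move=> /perm_uniq U; apply: word_compl; rewrite U.
have exch_a q : exchanged X (a, q) = word b c d q by apply: exchE.
have exch_b q : exchanged X (b, q) = word a c d q.
  by apply: exchE; apply/permP=> u /=; ring.
have exch_c q : exchanged X (c, q) = word a b d q.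
  by apply: exchE; apply/permP=> u /=; ring.
have exch_d q : exchanged X (d, q) = word a b c q.
  by apply: exchE; apply/permP=> u /=; ring.
(* The exchanges of a are listed by their complements, the words with a. *)
have wbcd_e : word b c d e = word a f g h.
  by apply: complE; apply/permP=> u /=; ring.
have wbcd_f : word b c d f = word a e g h.
  by apply: complE; apply/permP=> u /=; ring.
have wbcd_g : word b c d g = word a e f h.
  by apply: complE; apply/permP=> u /=; ring.
have wbcd_h : word b c d h = word a e f g.
  by apply: complE; apply/permP=> u /=; ring.
have row_a : block X [set a] (~: X) = A |: [set A_ i | i : 'I_4].
  rewrite (block_row _ _ XC_seq) (@imset_ord _ (nth A _)) /=.
  by rewrite !exch_a wbcd_e wbcd_f wbcd_g wbcd_h.
have row_bcd (j : 'I_3) : block X [set nth a [:: b; c; d] j] (~: X) =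
    A |: [set B_ j i | i : 'I_4].
  rewrite (block_row _ _ XC_seq) (@imset_ord _ (nth A _)).
  by case: j => [[|[|[|//]]] ltj] /=; rewrite ?(exch_b, exch_c, exch_d).
have col (i : 'I_4) : block X X [set nth e [:: e; f; g; h] i] =
    A |: (A_ i |: [set B_ j i | j : 'I_3]).
  rewrite (block_col _ _ X_seq) (@imset_ord _ (fun j => nth A (nth [::] _ j) i)).
  rewrite /= set_cons /A_ exch_a exch_b exch_c exch_d.
  by case: i => [[|[|[|[|//]]]] lti] /=; rewrite ?(wbcd_e, wbcd_f, wbcd_g, wbcd_h).
rewrite (maximum_strongly_independent_line S cX); split.
  case=> [[p pX ->]|[q qXC ->]]; last first.
    rewrite XC_seq inE in qXC; have /(nthP e)[i lti <-] := qXC.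
    by constructor 2; exists (Ordinal (lti : i < 4)); rewrite -col.
  rewrite X_seq inE in_cons in pX; have /orP[/eqP-> | /(nthP a)[j ltj <-]] := pX.
    by constructor 1; rewrite row_a.
  by constructor 3; exists (Ordinal (ltj : j < 3)); rewrite -row_bcd.
case=> [-> | [i ->] | [j ->]].
- by left; exists a; rewrite ?row_a // X_seq !inE eqxx.
- right; exists (nth e [:: e; f; g; h] i); last by rewrite col.
  by rewrite XC_seq inE mem_nth.
- left; exists (nth a [:: b; c; d] j); last by rewrite row_bcd.
  by rewrite X_seq inE in_cons mem_nth ?orbT.
Qed.
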